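(* Suppose that $\mathbb{G}$ is a ribbon graph with no loops. Then $j_{\min}(\mathbb{G})=1-|V(\mathbb{G})|$ and $$\bigoplus_{i\in\mathbb{Z}}\widetilde{Kh}^{i,1-|V(\mathbb{G})|}(\mathbb{G})\cong\widetilde{Kh}^{0,1-|V(\mathbb{G})|}(\mathbb{G})\cong\mathbb{Z}.$$
   Context: **Ribbon graphs.** A ribbon graph $\mathbb{G}$ (always oriented) is a finite nonempty graph (loops and multiple edges allowed) together with an embedding into a closed oriented surface $\Sigma$ whose complement is a disjoint union of open disks; equivalently, a graph with a cyclic order of the half-edges at each vertex. $V(\mathbb{G})$ is its vertex set. A loop is an edge joining a vertex to itself. $\Sigma_{\mathbb{G}}$ is a regular neighborhood of $\mathbb{G}$ in $\Sigma$: one disk per vertex and one band per edge. $F(\mathbb{G})$ is the set of boundary components of $\Sigma_{\mathbb{G}}$. A spanning ribbon subgraph $\mathbb{H}$ has the same vertices, a subset of the edges, and inherited cyclic orders; it has its own surface $\Sigma_{\mathbb{H}}$ and set $F(\mathbb{H})$. **Bigraded groups.** For a bigraded abelian group $M$ ($i$ homological, $j$ polynomial grading), $(M[r]\{s\})^{i,j}=M^{i-r,j-s}$. $V$ (without argument) is the free abelian group on $v_+,v_-$ in bigradings $(0,1),(0,-1)$. Define $m:V\otimes V\to V$ by $v_+\otimes v_+\mapsto v_+$, $v_+\otimes v_-\mapsto v_-$, $v_-\otimes v_+\mapsto v_-$, $v_-\otimes v_-\mapsto 0$, and $\Delta:V\to V\otimes V$ by $v_+\mapsto v_+\otimes v_-+v_-\otimes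 v_+$, $v_-\mapsto v_-\otimes v_-$. **Khovanov homology of a ribbon graph.** Let $\mathbb{G}$ have edges $e_1,\dots,e_n$. For $I=(m_1,\dots,m_n)\in\{0,1\}^n$ let $h(I)=\sum m_i$, let $\mathbb{G}(I)$ be the spanning ribbon subgraph with edge set $\{e_i: m_i=1\}$, and associate to $I$ the group $V^{\otimes F(\mathbb{G}(I))}[h(I)]\{h(I)\}$. $CKh(\mathbb{G})$ is the direct sum of these over all $I$. If $J$ is obtained from $I$ by changing the $k$th coordinate from $0$ to $1$ (a hypercube edge $\xi:I\to J$), adding the band of $e_k$ merges two boundary components or splits one into two; $d_\xi$ is $m$ (merge) or $\Delta$ (split) on the affected factors and the identity on the others. The differential is $d=\sum_\xi(-1)^{|\{i<k:\,m_i=1\}|}d_\xi$; it raises $i$ by 1 and preserves $j$. Reduced version: fix a marked point on the boundary of a vertex disk of $\Sigma_{\mathbb{G}}$ away from all bands; each $\Sigma_{\mathbb{G}(I)}$ has a unique boundary component containing it. $\widetilde{CKh}(\mathbb{G})$ is the subcomplex of $CKh(\mathbb{G})$ in which the factor of the marked component is $\mathbb{Z}v_-$, with polynomial grading shifted up by $1$; $\widetilde{Kh}(\mathbb{G})=\bigoplus\widetilde{Kh}^{i,j}(\mathbb{G})$ is its homology. $j_{\min}(\mathbb{G})=\min\{j : \bigoplus_{i\in\mathbb{Z}}\widetilde{Kh}^{i,j}(\mathbb{G})\neq0\}$. *)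

(* Defs.v *)
From HB Require Import structures.
From mathcomp Require Import boolp classical_sets cardinality.
From mathcomp Require Import all_boot all_order all_fingroup all_algebra.

Set Implicit Arguments.
Unset Strict Implicit.
Unset Printing Implicit Defensive.

Import Order.TTheory GRing.Theory Num.Theory.
Local Open Scope ring_scope.

Definition zmod_iso (A B : zmodType) : Prop :=
  exists f : {additive A -> B}, bijective f.

Definition zmod_nonzero (A : zmodType) : Prop := exists x : A, x != 0.

Section DirectSum.
Variables (I : Type) (A : I -> zmodType).

Record dsum := DSum {
  dsum_fun :> forall i, A i;
  dsum_finite : finite_set [set i | dsum_fun i <> 0]%classic
}.

Lemma dsum_eq (x y : dsum) : (forall i, x i = y i) -> x = y.
Proof.
case: x y => [f Hf] [g Hg] /= fg.
have {}fg : f = g by exact: functional_extensionality_dep.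
by subst g; rewrite (Prop_irrelevance Hf Hg).
Qed.

Lemma dsum_zero_subproof : finite_set [set i | (0 : A i) <> 0]%classic.
Proof. by apply: (sub_finite_set _ (finite_set0 I)) => i /=; apply. Qed.

Lemma dsum_opp_subproof (x : dsum) :
  finite_set [set i | - x i <> 0]%classic.
Proof.
apply: (sub_finite_set _ (dsum_finite x)) => i /= nz x0; apply: nz.
by rewrite x0 oppr0.
Qed.

Lemma dsum_add_subproof (x y : dsum) :
  finite_set [set i | x i + y i <> 0]%classic.
Proof.
have fxy : finite_set ([set i | x i <> 0] `|` [set i | y i <> 0])%classic.
  by rewrite finite_setU; split; apply: dsum_finite.
apply: (sub_finite_set _ fxy) => i /= nz.
have [x0|] := pselect (x i = 0); last by left.
by right=> y0; apply: nz; rewrite x0 y0 addr0.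
Qed.

Definition dsum_zero := DSum dsum_zero_subproof.
Definition dsum_opp x := DSum (dsum_opp_subproof x).
Definition dsum_add x y := DSum (dsum_add_subproof x y).

HB.instance Definition _ := gen_eqMixin dsum.
HB.instance Definition _ := gen_choiceMixin dsum.

Lemma dsum_addA : associative dsum_add.
Proof. by move=> x y z; apply: dsum_eq => i /=; rewrite addrA. Qed.
Lemma dsum_addC : commutative dsum_add.
Proof. by move=> x y; apply: dsum_eq => i /=; rewrite addrC. Qed.
Lemma dsum_add0 : left_id dsum_zero dsum_add.
Proof. by move=> x; apply: dsum_eq => i /=; rewrite add0r. Qed.
Lemma dsum_addN : left_inverse dsum_zero dsum_opp dsum_add.
Proof. by move=> x; apply: dsum_eq => i /=; rewrite addNr. Qed.

HB.instance Definition _ :=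
  GRing.isZmodule.Build dsum dsum_addA dsum_addC dsum_add0 dsum_addN.
End DirectSum.

Section Homology.
Variables (A : zmodType) (d : {additive A -> A}) (C' C : zmodClosed A).

Definition cycle_pred : {pred A} := [pred x | (x \in C) && (d x == 0)].

Lemma cycle_closed : zmod_closed cycle_pred.
Proof.
split=> [|x y]; rewrite !inE ?rpred0 ?raddf0 ?eqxx //.
by move=> /andP[xC /eqP dx] /andP[yC /eqP dy]; rewrite rpredB // raddfB /= dx dy subrr eqxx.
Qed.
HB.instance Definition _ := GRing.isZmodClosed.Build A cycle_pred cycle_closed.

Record cycles := Cycle { cycle_val : A; _ : cycle_val \in cycle_pred }.
HB.instance Definition _ := [isSub for cycle_val].
HB.instance Definition _ := [Choice of cycles by <:].
HB.instance Definition _ := [SubChoice_isSubZmodule of cycles by <:].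

Definition boundary_pred : {pred cycles} :=
  [pred z : cycles | `[< exists2 y, y \in C' & d y = cycle_val z >]].

Lemma boundary_closed : zmod_closed boundary_pred.
Proof.
split=> [|x y]; rewrite !inE.
  by apply/asboolP; exists 0; rewrite ?rpred0 ?raddf0 //.
move=> /asboolP[u uC du] /asboolP[v vC dv]; apply/asboolP.
by exists (u - v); rewrite ?rpredB ?raddfB /= ?du ?dv.
Qed.
HB.instance Definition _ :=
  GRing.isZmodClosed.Build cycles boundary_pred boundary_closed.

(* C' and C are consecutive terms of a complex, given as subgroups of A, whose
   differentials are restrictions of d. This is the homology at C: the group of
   cycles in C modulo the image of C'. *)
Definition homology : zmodType := Quotient.quot boundary_pred.
End Homology.

(* The edges are numbered, and (e, false), (e, true) are the two half-edges of
   the edge e. The permutation rot sends a half-edge to the next one in the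
   cyclic order at its vertex. Vertices without half-edges are allowed. *)
Record ribbon_graph := RibbonGraph {
  vertex : finType;
  nedges : nat;
  endpoint : 'I_nedges * bool -> vertex;
  rot : {perm 'I_nedges * bool};
  vertex_gt0 : (0 < #|vertex|)%N;
  rotP : forall h h',
    (h' \in porbit rot h) = (endpoint h == endpoint h')
}.

Section Khovanov.
Variable G : ribbon_graph.

Notation edge := 'I_(nedges G).
Notation half_edge := (edge * bool)%type.

Definition loopless : Prop :=
  forall e : edge, endpoint (e, false) <> endpoint (e, true) :> vertex G.

Definition isolated (v : vertex G) : bool :=
  ~~ [exists h : half_edge, endpoint h == v].

(* The feet of the bands cut the boundary circles of the vertex disks into arcs:
   inl h is the arc from the foot of h to the foot of rot h, and inr v is the
   whole circle of an isolated vertex v. A marked point away from the bands is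
   given by the arc containing it. *)
Definition corner : finType := (half_edge + {v : vertex G | isolated v})%type.

Definition flip (h : half_edge) : half_edge := (h.1, ~~ h.2).

(* Walk along the boundary of the surface of the spanning subgraph with edge set
   I, with the surface on the left. After the arc inl h comes the foot of rot h.
   If that band is present, its side leads to the end of the foot of
   flip (rot h), where the arc inl (flip (rot h)) starts; otherwise the walk
   crosses the place of the foot and goes on along inl (rot h). *)
Definition next_corner (I : {set edge}) (c : corner) : corner :=
  match c with
  | inl h => let h' : half_edge := rot G h in
             inl (if h'.1 \in I then flip h' else h')
  | inr v => inr v
  end.

Lemma flipK : involutive flip.
Proof. by case=> e b; rewrite /flip /= negbK. Qed.

Lemma next_corner_inj I : injective (next_corner I).
Proof.
move=> [h|v] [h'|v'] //= [] // E; congr inl; apply: (@perm_inj _ (rot G)).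
move: E; case: ifPn => hI; case: ifPn => h'I E //.
- exact: inv_inj flipK _ _ E.
- by rewrite -E hI in h'I.
- by rewrite E h'I in hI.
Qed.

Definition face_perm I : {perm corner} := perm (@next_corner_inj I).

(* The set F(G(I)) of boundary components; a component is represented by the
   set of corner arcs that it contains, which is never empty. *)
Definition face (I : {set edge}) : finType :=
  {C : {set corner} | C \in porbits (face_perm I)}.

Definition face_of (I : {set edge}) (c : corner) : face I :=
  exist _ (porbit (face_perm I) c) (imset_f _ (isT : c \in corner)).

(* The basis of V: true is v_+ and false is v_-. *)
Notation "'v+'" := true (only parsing).
Notation "'v-'" := false (only parsing).

(* Coefficient of c in m (a (x) b). *)
Definition mul_coef (a b c : bool) : int :=
  match a, b, c with
  | v+, v+, v+ => 1
  | v+, v-, v- => 1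
  | v-, v+, v- => 1
  | _, _, _ => 0
  end.

(* Coefficient of b (x) c in Delta a. *)
Definition comul_coef (a b c : bool) : int :=
  match a, b, c with
  | v+, v+, v- => 1
  | v+, v-, v+ => 1
  | v-, v-, v- => 1
  | _, _, _ => 0
  end.

(* Basis of CKh(G): a vertex I of the cube, with a basis element of the tensor
   power of V over F(G(I)), i.e. a labelling of F(G(I)) by v_+ and v_-. *)
Definition state : finType := {I : {set edge} & {ffun face I -> bool}}.

Definition label (s : state) (c : corner) : bool :=
  tagged s (face_of (tag s) c).

Definition hdeg (s : state) : int := #|tag s|%:Z.

Definition qdeg (s : state) : int :=
  #|[set C | tagged s C]|%:Z - #|[set C | ~~ tagged s C]|%:Z + #|tag s|%:Z.

(* Coefficient of t in d_xi(s), where xi : I -> J adds the edge k to I.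
   In G(I) the two places where the band of k gets attached lie on the
   components of the arcs following the two half-edges of k; in G(J) these arcs
   follow the two sides of the band. So these are the affected components. *)
Definition dxi_coef (k : edge) (s t : state) : int :=
  let I := tag s in
  let c0 : corner := inl (k, false) in
  let c1 : corner := inl (k, true) in
  if [forall c, [|| face_of I c == face_of I c0, face_of I c == face_of I c1
                  | label s c == label t c]]
  then if face_of I c0 != face_of I c1
       then mul_coef (label s c0) (label s c1) (label t c0)
       else comul_coef (label s c0) (label t c0) (label t c1)
  else 0.

Definition d_coef (s t : state) : int :=
  \sum_(k | (k \notin tag s) && (tag t == k |: tag s))
     (-1) ^+ #|[set i in tag s | (i < k)%N]| * dxi_coef k s t.

Definition CKh : zmodType := {ffun state -> int}.

Definition dKh (x : CKh) : CKh := [ffun t => \sum_s x s * d_coef s t].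

Lemma dKh_zmod_morphism : zmod_morphism dKh.
Proof.
move=> x y; apply/ffunP => t; rewrite !ffunE -sumrB.
by apply: eq_bigr => s _; rewrite !ffunE mulrBl.
Qed.
HB.instance Definition _ :=
  GRing.isZmodMorphism.Build CKh CKh dKh dKh_zmod_morphism.

Section Reduced.
Variable p : corner.

(* The part of bidegree (i, j) of the reduced complex marked at p. *)
Definition rCKh (i j : int) : {pred CKh} :=
  [pred x : CKh | [forall s : state, (x s != 0) ==>
    [&& label s p == v-, hdeg s == i & qdeg s + 1 == j]]].

Lemma rCKh_closed i j : zmod_closed (rCKh i j).
Proof.
split=> [|x y]; rewrite !inE; first by apply/forallP => s; rewrite ffunE eqxx.
move=> /forallP Hx /forallP Hy; apply/forallP => s; apply/implyP.
rewrite !ffunE; have [x0|xn0] := eqVneq (x s) 0; last by rewrite (implyP (Hx s)).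
have [y0|yn0] := eqVneq (y s) 0; last by rewrite (implyP (Hy s)).
by rewrite x0 y0 subrr eqxx.
Qed.
HB.instance Definition _ i j :=
  GRing.isZmodClosed.Build CKh (rCKh i j) (rCKh_closed i j).

Definition rKh (i j : int) : zmodType :=
  homology dKh (rCKh (i - 1) j) (rCKh i j).

Definition rKh_total (j : int) : zmodType := dsum (fun i : int => rKh i j).

Definition is_jmin (j : int) : Prop :=
  let S : set int := [set j' | zmod_nonzero (rKh_total j')]%classic in
  S j /\ lbound S j.

End Reduced.
End Khovanov.

(* Main.v *)
From HB Require Import structures.
Require Import Defs.
From mathcomp Require Import boolp classical_sets cardinality.
From mathcomp Require Import all_boot all_order all_fingroup all_algebra.
From mathcomp Require Import zify.

Set Implicit Arguments.
Unset Strict Implicit.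
Unset Printing Implicit Defensive.

Import Order.TTheory GRing.Theory Num.Theory.
Local Open Scope ring_scope.

(** At the bottom of the polynomial grading the reduced complex has a single
generator, so no homology has to be computed there.

A generator is a spanning subgraph I with a labelling of F(G(I)) by v_+ and v_-,
and its degree q satisfies q >= |I| - |F(G(I))|, with equality exactly when all
labels are v_-. Each added band changes the number of boundary components by exactly
one, and without loops the first band joins two different vertex disks, so it
merges. Hence |F(G(I))| <= |V| + |I|, and |F(G(I))| <= |V| + |I| - 2 as soon as
I is nonempty ([card_face_le]). It follows that q >= -|V|, with equality only
for the empty subgraph with all labels v_- ([qdeg_le_bottom]).

After the reduced shift, the complex therefore vanishes in degrees
j < 1 - |V|, and in degree j = 1 - |V| it is Z, placed in homological degree 0.
That generator is a cycle, since every edge out of the empty subgraph is a merge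
and m(v_- (x) v_-) = 0; it is not a boundary, since there are no chains in
homological degree -1. So the homology in degree 1 - |V| is Z.

The change in the number of components comes from the permutations whose cycles
are the components: adding the edge k multiplies the permutation by the
transposition of the two corners that follow the half-edges of k
([face_perm_add]), and a transposition either joins two cycles or cuts one. *)

(** * Direct sums *)

Section Dsum.
Variables (I : Type) (A : I -> zmodType).

Lemma dsum_trivial (A0 : forall i (a : A i), a = 0) : ~ zmod_nonzero (dsum A).
Proof.
case=> x /negP; apply; apply/eqP/dsum_eq => i.
by rewrite (A0 i (x i)) [RHS]A0.
Qed.

Definition dsum_proj (i : I) (x : dsum A) : A i := x i.

Lemma dsum_proj_zmod_morphism i : zmod_morphism (dsum_proj i).
Proof. by []. Qed.
HB.instance Definition _ (i : I) :=
  GRing.isZmodMorphism.Build (dsum A) (A i) (dsum_proj i)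
    (dsum_proj_zmod_morphism i).

(** The type of a component depends on its index, so placing [a] at the index
[i] needs a transport along [i = k]. *)
Definition single_fun (i : I) (a : A i) (k : I) : A k :=
  if pselect (i = k) is left e then ecast k (A k) e a else 0.

Lemma single_finite i (a : A i) :
  finite_set [set k | single_fun a k <> 0]%classic.
Proof.
apply: (sub_finite_set _ (finite_set1 i)) => k /=.
by rewrite /single_fun; case: pselect.
Qed.

Lemma dsum_iso_summand (i : I) :
  (forall k, k <> i -> forall a : A k, a = 0) -> zmod_iso (dsum A) (A i).
Proof.
move=> A0; exists (dsum_proj i : {additive dsum A -> A i}).
have single_i (a : A i) : single_fun a i = a.
  by rewrite /single_fun; case: pselect => // e;
    rewrite (Prop_irrelevance e erefl).
exists (fun a => DSum (single_finite a)) => [x|a] /=; last exact: single_i.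
apply: dsum_eq => k /=; have [->|ki] := pselect (k = i); first exact: single_i.
by rewrite (A0 k ki (x k)) [LHS](A0 k ki).
Qed.
End Dsum.

(** * Homology in elementary cases *)

Section HomologyComputations.
Variables (A : zmodType) (d : {additive A -> A}) (C' C : zmodClosed A).

Lemma homology_trivial :
  (forall x, x \in C -> x = 0) -> forall h : homology d C' C, h = 0.
Proof.
move=> C0; elim/quotW => x; have -> : x = 0; last exact: pi_zeror.
by apply: val_inj; case: x => x /= /andP[/C0].
Qed.

(** When there are no chains below, cycles and classes coincide; when the chains
are the multiples of a cycle z on which the coordinate g is 1, the coordinate
identifies them with the integers. *)
Lemma homology_iso_int (g : {additive A -> int}) (z : A) :
    (forall x, x \in C' -> x = 0) -> z \in C -> d z = 0 -> g z = 1 ->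
    (forall x, x \in C -> x = z *~ g x) ->
  zmod_iso (homology d C' C) int.
Proof.
move=> C'0 zC dz gz Cz; pose H := Quotient.quot (@boundary_pred _ d C' C).
(* The only boundary is 0, so the chosen representative of a class is its unique
   cycle, and choosing representatives is additive. *)
have bd0 (x : cycles d C) : x \in @boundary_pred _ d C' C -> x = 0.
  move=> /asboolP[y /C'0 -> ]; rewrite raddf0 => x0.
  by apply: val_inj => /=; rewrite -x0.
have repr_pi (x : cycles d C) : generic_quotient.repr (\pi_H x)%qT = x.
  apply/eqP; rewrite -subr_eq0; apply/eqP/bd0.
  by rewrite Quotient.idealrBE reprK.
have cycP n : z *~ n \in cycle_pred d C.
  by rewrite inE rpredMz //= raddfMz /= dz mul0rz eqxx.
pose f (h : H) : int := g (val (generic_quotient.repr h)).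
have fadd : zmod_morphism f.
  elim/quotW => x; elim/quotW => y.
  by rewrite /f -raddfB !repr_pi /= raddfB.
pose fM := GRing.isZmodMorphism.Build H int f fadd.
pose F : {additive H -> int} := HB.pack f fM.
exists F, (fun n => \pi_H%qT (Cycle (cycP n))) => [|n] /=.
  elim/quotW => x; congr (\pi_H%qT _); apply: val_inj; rewrite /f repr_pi /=.
  by case: x => x /= /andP[/Cz].
by rewrite /f repr_pi /= raddfMz gz intz.
Qed.
End HomologyComputations.

(** * Counting boundary components *)

Section Ribbon.
Variable G : ribbon_graph.
Implicit Types (I : {set 'I_(nedges G)}) (s : state G) (x : CKh G).

Definition corner_vertex (c : corner G) : vertex G :=
  match c with inl h => endpoint h | inr v => val v end.

Lemma corner_vertex_surj v : exists c, corner_vertex c = v.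
Proof.
have [/existsP[h /eqP hv]|v0] := boolP [exists h, @endpoint G h == v].
  by exists (inl h).
by exists (inr (exist _ v v0)).
Qed.

Lemma face0_iter_inl n (h : 'I_(nedges G) * bool) :
  (face_perm set0 ^+ n)%g (inl h) = inl ((Defs.rot G ^+ n)%g h).
Proof.
elim: n => [|n IHn]; first by rewrite !expg0 !perm1.
by rewrite !expgSr !permM IHn permE /= inE.
Qed.

Lemma face0_iter_inr n (v : {v : vertex G | isolated v}) :
  (face_perm set0 ^+ n)%g (inr v) = inr v.
Proof.
by elim: n => [|n IHn]; rewrite ?expg0 ?perm1 // expgSr permM IHn permE.
Qed.

(** Without bands the surface is the disjoint union of the vertex disks, whose
boundary circles are the cycles of the rotation. *)
Lemma face0_vertex (c c' : corner G) :
  (c' \in porbit (face_perm set0) c) = (corner_vertex c == corner_vertex c').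
Proof.
apply/porbitP/eqP => [[n ->]|].
  case: c => [h|v]; last by rewrite face0_iter_inr.
  by rewrite face0_iter_inl /=; apply/eqP; rewrite -rotP mem_porbit.
case: c c' => [h|v] [h'|v'] /=.
- move/eqP; rewrite -rotP => /porbitP[n ->].
  by exists n; rewrite face0_iter_inl.
- by case: v' => v' /= iv' hv; case/existsP: iv'; exists h; apply/eqP.
- by case: v => v /= iv hv; case/existsP: iv; exists h'; apply/eqP.
- by move=> /val_inj ->; exists 0; rewrite expg0 perm1.
Qed.

Lemma card_face0 : #|porbits (@face_perm G set0)| = #|vertex G|.
Proof.
pose fiber v := [set c | corner_vertex c == v].
have fiberE c : porbit (face_perm set0) c = fiber (corner_vertex c).
  by apply/setP => c'; rewrite face0_vertex inE eq_sym.
rewrite -(card_imset _ (f := fiber)) => [|v w E].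
  apply: eq_card => C; apply/imsetP/imsetP => -[].
    by move=> c _ ->; exists (corner_vertex c).
  move=> v _ ->; have [c <-] := corner_vertex_surj v.
  by exists c; rewrite ?fiberE.
have [c cv] := corner_vertex_surj v.
by move/setP/(_ c): E; rewrite !inE cv eqxx => /esym/eqP.
Qed.

(** Walking along the boundary, the new band only matters when the walk arrives
at one of its feet, and then it crosses to the other foot. *)
Lemma face_perm_add I (k : 'I_(nedges G)) : k \notin I ->
  face_perm (k |: I) =
  (face_perm I * tperm (inl (k, false)) (inl (k, true)))%g.
Proof.
move=> kI; apply/permP => c; rewrite permM [LHS]permE [face_perm I c]permE.
case: c => [h|v] /=; last by rewrite tpermD.
case: (Defs.rot G h) => e b /=; rewrite in_setU1.
have [->|ek] := eqVneq e k.
  by rewrite (negPf kI) /flip; case: b; rewrite ?tpermL ?tpermR.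
have nek b' b'' : inl (k, b'') != inl (e, b') :> corner G.
  by apply: contraNneq ek => -[-> _].
by rewrite /=; case: ifP; rewrite /flip tpermD.
Qed.

(** A band attached to two different components merges them, and a band with both
feet on the same component splits it. *)
Lemma card_face_add I (k : 'I_(nedges G)) : k \notin I ->
  (#|porbits (face_perm (k |: I))| +
     (inl (k, false) \notin porbit (face_perm I) (inl (k, true))).*2
   = #|porbits (face_perm I)| + 1)%N.
Proof.
move=> kI; rewrite (face_perm_add kI) -porbitsV invMg tpermV.
(* [porbits_mul_tperm] has the transposition on the other side; inverting all
   permutations changes neither the cycles nor their number. *)
rewrite -[porbits (face_perm I)]porbitsV -[porbit _ _]porbitV.
have ne : inl (k, false) != inl (k, true) :> corner G by apply/eqP => -[].
by rewrite porbits_mul_tperm ne.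
Qed.

Section Loopless.
Hypothesis noloop : loopless G.

(** Every band creates at most one component, and the first band, which is not a
loop, destroys one: this is the gap of two for nonempty [I]. *)
Lemma card_face_le I :
  (#|porbits (face_perm I)| + (I != set0).*2 <= #|vertex G| + #|I|)%N.
Proof.
move: {2}#|I| (erefl #|I|) => n; elim: n I => [|n IHn] I cardI.
  by rewrite (cards0_eq cardI) card_face0 eqxx cards0.
have /card_gt0P[k kI] : (0 < #|I|)%N by rewrite cardI.
have kI' : k \notin I :\ k by rewrite !inE eqxx.
have := cardsD1 k I; rewrite kI => cI'.
have := IHn (I :\ k) ltac:(lia); have := card_face_add kI'.
rewrite setD1K // cI'.
have -> /= : I != set0 by apply/set0Pn; exists k.
have [->|_] := eqVneq (I :\ k) set0; last by case: (_ \notin _); lia.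
have -> : (inl (k, false) \in porbit (face_perm set0) (inl (k, true))) = false.
  by rewrite face0_vertex; apply/eqP => /esym; apply: noloop.
by rewrite cards0 card_face0 /=; lia.
Qed.

(** * The generator of lowest degree *)

Definition bottom : state G :=
  Tagged (fun I => {ffun face I -> bool})
    ([ffun=> false] : {ffun face set0 -> bool}).

Lemma label_bottom c : label bottom c = false.
Proof. by rewrite /label ffunE. Qed.

Lemma qdeg_bottom : qdeg bottom = - #|vertex G|%:Z.
Proof.
rewrite /qdeg /= cards0 addr0.
have -> : [set C | (tagged bottom) C] = set0.
  by apply/setP => C; rewrite !inE ffunE.
have -> : [set C | ~~ (tagged bottom) C] = setT.
  by apply/setP => C; rewrite !inE ffunE.
by rewrite cards0 cardsT card_sig card_face0 sub0r.
Qed.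

(** With P components labelled v_+ and N labelled v_-, the hypothesis reads
P + |I| + |V| <= N, whereas P + N <= |V| + |I|, with a gap of two if I is
nonempty; together these force P = 0 and I empty. *)
Lemma qdeg_le_bottom s : qdeg s <= - #|vertex G|%:Z -> s = bottom.
Proof.
case: s => I l; rewrite /qdeg /=; set P := [set C | l C].
have -> : [set C | ~~ l C] = ~: P by apply/setP => C; rewrite !inE.
have cardP : (#|P| + #|~: P| = #|porbits (face_perm I)|)%N.
  by rewrite cardsC card_sig.
move=> qle; have cardI := card_face_le I.
have [I0 P0] : I = set0 /\ #|P| = 0%N.
  have [P0 I0] : #|P| = 0%N /\ (I != set0) = false.
    move: qle cardI; rewrite -cardP.
    move: #|P| #|~: P| #|I| #|vertex G| => a b c v.
    by case: (I != set0) => /=; lia.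
  by split=> //; apply/eqP; rewrite -[_ == _]negbK I0.
move/cards0_eq: P0 => P0.
subst I; rewrite /bottom; congr existT; apply/ffunP => C; rewrite ffunE.
by have := in_set0 C; rewrite -P0 inE.
Qed.

Definition bottom_chain : CKh G := [ffun s => (s == bottom)%:R].

(** Since no edge is a loop, every differential out of the empty subgraph is a
merge, and it multiplies v_- by v_-. *)
Lemma d_bottom_chain : dKh bottom_chain = 0.
Proof.
apply/ffunP => t; rewrite !ffunE big1 // => s _; rewrite ffunE.
have [->|_] := eqVneq s bottom; last by rewrite mul0r.
rewrite mul1r; apply: big1 => k _; rewrite /dxi_coef !label_bottom.
case: ifP => _; last by rewrite mulr0.
suff -> : face_of (tag bottom) (inl (k, false))
          != face_of (tag bottom) (inl (k, true)).
  by rewrite mulr0.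
rewrite -val_eqE /= eq_porbit_mem face0_vertex.
by apply/eqP => /esym; apply: noloop.
Qed.

Section Marked.
Variable p : corner G.
Let jm : int := 1 - #|vertex G|%:Z.

(** The reduced complex shifts the polynomial grading by one, so the bound
[- #|vertex G|] on [qdeg] becomes [jm]. *)
Lemma rCKh_supp i j x : j <= jm -> x \in rCKh p i j ->
  forall s, x s != 0 -> [/\ s = bottom, i = 0 & j = jm].
Proof.
move=> jle /forallP xP s xs; have := xP s; rewrite xs /=.
case/and3P => _ /eqP hs /eqP qs.
have sb : s = bottom by apply: qdeg_le_bottom; rewrite /jm in jle; lia.
rewrite -hs -qs sb qdeg_bottom /hdeg /= cards0 /jm.
by split=> //; rewrite addrC.
Qed.

Lemma rCKh_eq0 i j : j <= jm -> (i, j) != (0, jm) ->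
  forall x, x \in rCKh p i j -> x = 0.
Proof.
move=> jle ij x /(rCKh_supp jle) xs; apply/ffunP => s; rewrite [RHS]ffunE.
apply/eqP; apply: contraNT ij => /xs[_ -> ->].
exact: eqxx.
Qed.

Definition bottom_coef (x : CKh G) : int := x bottom.

Lemma bottom_coef_zmod_morphism : zmod_morphism bottom_coef.
Proof. by move=> x y; rewrite /bottom_coef !ffunE. Qed.
HB.instance Definition _ :=
  GRing.isZmodMorphism.Build (CKh G) int bottom_coef bottom_coef_zmod_morphism.

Lemma bottom_chain_rCKh : bottom_chain \in rCKh p 0 jm.
Proof.
apply/forallP => s; apply/implyP; rewrite ffunE.
have [-> _|] := eqVneq s bottom; last by rewrite eqxx.
by rewrite label_bottom qdeg_bottom /hdeg /= cards0 addrC !eqxx.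
Qed.

Lemma rKh_bottom : zmod_iso (rKh p 0 jm) int.
Proof.
apply: (homology_iso_int (g := bottom_coef) (z := bottom_chain)).
- exact: rCKh_eq0.
- exact: bottom_chain_rCKh.
- exact: d_bottom_chain.
- by rewrite /= /bottom_coef ffunE eqxx.
move=> x /(rCKh_supp (lexx _)) xs; apply/ffunP => s.
have -> : (bottom_chain *~ bottom_coef x) s = bottom_chain s *~ bottom_coef x.
  case: (bottom_coef x) => n; first by rewrite -!pmulrn ffunMnE.
  by rewrite NegzE !mulrNz -!pmulrn -ffunMnE [LHS]ffunE.
rewrite ffunE; have [->|sb] := eqVneq s bottom; first by rewrite intz.
by rewrite mul0rz; apply/eqP; apply: contraNT sb => /xs[->].
Qed.

Lemma rKh_eq0 i j : j <= jm -> (i, j) != (0, jm) -> forall h : rKh p i j, h = 0.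
Proof. by move=> jle ij; apply: homology_trivial; apply: rCKh_eq0. Qed.

End Marked.
End Loopless.
End Ribbon.

Theorem theorem1p4 (G : ribbon_graph) (p : corner G) (noloop : loopless G) :
  let jm : int := 1 - #|vertex G|%:Z in
  [/\ is_jmin p jm,
      zmod_iso (rKh_total p jm) (rKh p 0 jm)
    & zmod_iso (rKh p 0 jm) int].
Proof.
move=> jm; have iso0 := rKh_bottom noloop p.
have isoT : zmod_iso (rKh_total p jm) (rKh p 0 jm).
  apply: dsum_iso_summand => i i0; apply: rKh_eq0 => //.
  by apply: contra_not_neq i0 => -[].
split=> //; split=> [|j nz].
  have [[f [f' _ fK]] [g [g' _ gK]]] := (isoT, iso0).
  exists (f' (g' 1)); apply/eqP => E.
  by have := gK 1; rewrite -[g' 1]fK E !raddf0.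
rewrite leNgt; apply/negP => jlt; apply: dsum_trivial nz => i.
apply: rKh_eq0 (ltW jlt) _ => //.
by apply: contraTneq jlt => -[_ ->]; rewrite ltxx.
Qed.
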